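(* Let $K$ be a field with a valuation $\mathrm{val}\colon K^*\to\mathbb R$ with value group $\Gamma$, admitting a group homomorphism $\Gamma\to K^*$, $\gamma\mapsto t^\gamma$, with $\mathrm{val}(t^\gamma)=\gamma$, and let $S=K[x_1,\dots,x_n]$. The normal form algorithm whose steps are listed in the context has the following input and output. Input: nonzero homogeneous polynomials $\{g_1,\dots,g_s\}$ in $S$, a homogeneous polynomial $f\in S$, a weight vector $w\in\mathbb R^n$, and a monomial term order $\prec$. Output: homogeneous polynomials $h_1,\dots,h_s,r\in S$ satisfying $$f=\sum_{i=1}^s h_ig_i+r,$$ where $h_ig_i\ge f$ for $1\le i\le s$, and $r\ge f$, in the order on polynomials defined in the context. In addition, writing $r=\sum b_vx^v$ with $b_v\in K$, $b_v\ne 0$ implies that $x^v$ is not divisible by any $\mathrm{lm}(g_i)$. The polynomial $r$ is called a remainder, or normal form, of dividing $f$ by $\{g_1,\dots,g_s\}$.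
   Context: Notation. $R=\{a\in K:\mathrm{val}(a)\ge 0\}\cup\{0\}$ is the valuation ring, $\mathfrak m$ its maximal ideal, $\Bbbk=R/\mathfrak m$ the residue field, and $\overline a$ denotes the image of $a\in R$ in $\Bbbk$. For nonzero $f=\sum c_ux^u\in S$ and $w\in\mathbb R^n$, let $W=\min\{\mathrm{val}(c_u)+w\cdot u: c_u\ne 0\}$ and $$\mathrm{in}_w(f)=\sum_{\mathrm{val}(c_u)+w\cdot u=W}\overline{t^{-\mathrm{val}(c_u)}c_u}\,x^u\in\Bbbk[x_1,\dots,x_n].$$ A term order $\prec$ is a monomial order in the usual Gröbner sense; $\mathrm{in}_\prec$ denotes the leading ($\prec$-largest) term. $\mathrm{lm}(f)$ is the monomial $x^u$ occurring in $\mathrm{in}_\prec(\mathrm{in}_w(f))$, and $\mathrm{lc}(f)\in K$ is the coefficient of this $x^u$ in $f$. Order on polynomials. For nonzero homogeneous $f,g$ with $\mathrm{lm}(f)=x^u$, $\mathrm{lm}(g)=x^v$, $\mathrm{lc}(f)=a$, $\mathrm{lc}(g)=b$: $f<g$ if $\mathrm{val}(a)+w\cdot u<\mathrm{val}(b)+w\cdot v$, or if $\mathrm{val}(a)+w\cdot u=\mathrm{val}(b)+w\cdot v$ and $x^u\succ x^v$. Also $f<0$ for all nonzero $f$. We write $g\ge f$ when $g<f$ does not hold. The function $E$. The algorithm uses a function $E(f,g)$ which takes two homogeneous polynomials and returns a nonnegative integer. It is left unspecified in the algorithm, as different choices may be used; one choice that ensures termination is $E(f,g)=|\{u: b_u\ne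 0,\ c_u=0\}|$ for $f=\sum c_ux^u$, $g=\sum b_ux^u$. Steps of the normal form algorithm. (1) Initialize: $T=\{g_1,\dots,g_s\}$, $h_{10}=\dots=h_{s0}=0$, $q_0=f$, $r_0=0$, $j=0$. (2) While $q_j\neq 0$ do: (a) Move to remainder: if there is no $g\in T$ with $\mathrm{lm}(g)$ dividing $\mathrm{lm}(q_j)$, set $r_{j+1}=r_j+\mathrm{lc}(q_j)\mathrm{lm}(q_j)$, $q_{j+1}=q_j-\mathrm{lc}(q_j)\mathrm{lm}(q_j)$, $h_{i,j+1}=h_{ij}$ for all $i$, and $T=T\cup\{q_j\}$. (b) Divide: otherwise, (i) choose $g\in T$ such that $\mathrm{lm}(g)$ divides $\mathrm{lm}(q_j)$ with $E(q_j,g)$ minimal among all such choices. (ii) If $E(q_j,g)>0$ set $T=T\cup\{q_j\}$. (iii) Let $x^v$ be the monomial with $\mathrm{lm}(x^vg)=\mathrm{lm}(q_j)$, set $c_v=\mathrm{lc}(q_j)/\mathrm{lc}(x^vg)\in K$, and let $p=q_j-c_vx^vg$. (iv) If $g=g_m$ for some $1\le m\le s$, set $q_{j+1}=p$, $h_{m,j+1}=h_{mj}+c_vx^v$, $h_{i,j+1}=h_{ij}$ for $i\ne m$, and $r_{j+1}=r_j$. (v) If $g$ was added to $T$ at some previous iteration, so $g=q_m$ for some $m<j$, set $q_{j+1}=\frac1{1-c_v}p$, $h_{i,j+1}=\frac1{1-c_v}(h_{ij}-c_vh_{im})$ for all $i$, and $r_{j+1}=\frac1{1-c_v}(r_j-c_vr_m)$.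 (c) Set $j=j+1$. (3) Output $h_i=h_{ij}$ for $1\le i\le s$ and $r=r_j$. *)

(* Defs.v *)
From HB Require Import structures.
From mathcomp Require Import all_boot all_order all_algebra.
From mathcomp Require Import generic_quotient ring_quotient.
From mathcomp Require Import reals.
From mathcomp Require Import mpoly.

Set Implicit Arguments.
Unset Strict Implicit.
Unset Printing Implicit Defensive.

Import Order.TTheory GRing.Theory Num.Theory.
Local Open Scope ring_scope.

(* A valuation K^* -> R, encoded as a total function on K: its value at 0 is
   junk, and is never used below. *)
Record valuation (K : fieldType) (R : realType) := Valuation {
  vfun :> K -> R;
  valuationM : forall a b, a != 0 -> b != 0 -> vfun (a * b) = vfun a + vfun b;
  valuationD : forall a b, a != 0 -> b != 0 -> a + b != 0 ->
    Num.min (vfun a) (vfun b) <= vfun (a + b)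
}.

Definition value_group (K : fieldType) (R : realType) (v : valuation K R)
    (gamma : R) : Prop :=
  exists2 a, a != 0 & v a = gamma.

(* gamma |-> t^gamma is a homomorphism from the value group to K^* with
   val (t^gamma) = gamma; the values of t outside the value group are junk. *)
Definition splitting (K : fieldType) (R : realType) (v : valuation K R)
    (t : R -> K) : Prop :=
  [/\ forall c, value_group v c -> t c != 0,
      forall c d, value_group v c -> value_group v d -> t (c + d) = t c * t d
    & forall c, value_group v c -> v (t c) = c].

Section ResidueField.
Variables (K : fieldType) (R : realType) (v : valuation K R).

Definition valring_pred : {pred K} := [pred a | (a == 0) || (0 <= v a)].

Lemma valuation1 : v 1 = 0.
Proof.
have /eqP := @valuationM _ _ v 1 1 (oner_neq0 K) (oner_neq0 K).
by rewrite mulr1 -subr_eq0 opprD addNKr oppr_eq0 => /eqP.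
Qed.

Lemma valuationN a : v (- a) = v a.
Proof.
have vN1 : v (- 1) = 0.
  have N1 : (- 1 : K) != 0 by rewrite oppr_eq0 oner_neq0.
  have /eqP := @valuationM _ _ v _ _ N1 N1.
  by rewrite mulrNN mulr1 valuation1 eq_sym -mulr2n mulrn_eq0 /= => /eqP.
have [->|a0] := eqVneq a 0; first by rewrite oppr0.
by rewrite -mulN1r valuationM ?oppr_eq0 ?oner_neq0 // vN1 add0r.
Qed.

Fact valring_subring : subring_closed valring_pred.
Proof.
split=> [|x y|x y]; rewrite !inE.
- by rewrite valuation1 lexx orbT.
- move=> hx hy; have [//|xy0 /=] := eqVneq (x - y) 0.
  have [x0|x0] := eqVneq x 0.
    move: hy xy0; rewrite x0 sub0r oppr_eq0 valuationN.
    by case: eqVneq => //.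
  have [y0|y0] := eqVneq y 0; first by move: hx; rewrite y0 subr0 (negPf x0).
  move: hx hy; rewrite (negPf x0) (negPf y0) /= => hx hy.
  have Ny0 : - y != 0 by rewrite oppr_eq0.
  apply: (le_trans _ (valuationD v x0 Ny0 xy0)).
  by rewrite valuationN le_min hx hy.
- have [->|x0] := eqVneq x 0; first by rewrite mul0r eqxx.
  have [->|y0] := eqVneq y 0; first by rewrite mulr0 eqxx.
  by move=> /= hx hy; rewrite valuationM // addr_ge0 ?orbT.
Qed.

HB.instance Definition _ :=
  GRing.isSubringClosed.Build K valring_pred valring_subring.

Record valring := ValRing {
  valring_val :> K;
  valring_valP : valring_val \in valring_pred
}.

HB.instance Definition _ := [isSub for valring_val].
HB.instance Definition _ := [Choice of valring by <:].
HB.instance Definition _ := [SubChoice_isSubComNzRing of valring by <:].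

(* The maximal ideal of the valuation ring. *)
Definition maxideal : {pred valring} :=
  [pred a : valring | (a == 0) || (0 < v (valring_val a))].

Fact maxideal_idealr : idealr_closed maxideal.
Proof.
split=> [||a x y]; rewrite !inE ?eqxx //.
  by rewrite negb_or oner_neq0 /= valuation1 ltxx.
have [ax0|ax0] := eqVneq (a * x) 0; first by rewrite ax0 add0r.
have [xy0|/= xy0] := eqVneq (a * x + y) 0; first by [].
have [x0|x0] := eqVneq x 0; first by rewrite x0 mulr0 eqxx in ax0.
have [a0|a0] := eqVneq a 0; first by rewrite a0 mul0r eqxx in ax0.
have nz (b : valring) : b != 0 -> valring_val b != 0 by [].
move=> /= hx.
have hax : 0 < v (valring_val (a * x)).
  have -> : valring_val (a * x) = valring_val a * valring_val x.
    by rewrite -[LHS]/(\val (a * x)) rmorphM.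
  rewrite (valuationM v (nz _ a0) (nz _ x0)); apply: ltr_wpDl hx.
  by have := valring_valP a; rewrite inE (negPf (nz _ a0)).
have [->|y0 /= hy] := eqVneq y 0; first by rewrite addr0.
have axyE : valring_val (a * x + y) = valring_val (a * x) + valring_val y.
  by rewrite -[LHS]/(\val (a * x + y)) rmorphD.
have axy0 := nz _ xy0; rewrite axyE in axy0 *.
apply: (lt_le_trans _ (valuationD v (nz _ ax0) (nz _ y0) axy0)).
by rewrite lt_min hax.
Qed.

HB.instance Definition _ := isIdealr.Build valring maxideal maxideal_idealr.

Definition residue_field := {ideal_quot maxideal}.

(* The image in the residue field of a in the valuation ring; 0 for a outside
   the valuation ring. *)
Definition residue (a : K) : residue_field :=
  \pi_residue_field%qT (insubd (0 : valring) a).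

End ResidueField.

Record term_order (n : nat) := TermOrder {
  term_le :> rel 'X_{1..n};
  term_le_anti : antisymmetric term_le;
  term_le_trans : transitive term_le;
  term_le_total : total term_le;
  term_le_0 : forall m, term_le 0%MM m;
  term_le_add : forall m m1 m2, term_le m1 m2 -> term_le (m + m1)%MM (m + m2)%MM
}.

(* The exponent of the leading term of a nonzero p. *)
Definition lead_exp (n : nat) (prec : term_order n) (k : nzRingType)
    (p : {mpoly k[n]}) : 'X_{1..n} :=
  last 0%MM (sort prec (msupp p)).

Section LeadingTerms.
Variables (K : fieldType) (R : realType) (n : nat).
Variables (v : valuation K R) (t : R -> K) (w : 'I_n -> R).
Variable (prec : term_order n).
Implicit Types f g : {mpoly K[n]}.

(* val a + w . u *)
Definition wval (a : K) (u : 'X_{1..n}) : R :=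
  v a + \sum_(i < n) w i * (u i)%:R.

Definition wmin f : R :=
  \big[Num.min/wval f@_(head 0%MM (msupp f)) (head 0%MM (msupp f))]_(u <- msupp f)
    wval f@_u u.

Definition inw f : {mpoly (residue_field v)[n]} :=
  \sum_(u <- msupp f | wval f@_u u == wmin f)
    residue v (t (- v f@_u) * f@_u) *: 'X_[u].

(* Monomials are represented by their exponents. *)
Definition lm f : 'X_{1..n} := lead_exp prec (inw f).

Definition lc f : K := f@_(lm f).

Definition poly_lt f g : bool :=
  (f != 0) &&
  [|| g == 0,
      wval (lc f) (lm f) < wval (lc g) (lm g)
    | [&& wval (lc f) (lm f) == wval (lc g) (lm g),
          prec (lm g) (lm f) & lm g != lm f]].

(* poly_ge g f reads g >= f. *)
Definition poly_ge g f : bool := ~~ poly_lt g f.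

End LeadingTerms.

(* |{u : b_u <> 0, c_u = 0}| for f = sum c_u x^u and g = sum b_u x^u *)
Definition Esupp (K : fieldType) (n : nat) (f g : {mpoly K[n]}) : nat :=
  count (fun u => f@_u == 0) (msupp g).

Record nf_state (K : fieldType) (n s : nat) := NFState {
  nf_T : seq {mpoly K[n]};  (* used only as a set, through membership *)
  nf_h : 'I_s -> {mpoly K[n]};
  nf_q : {mpoly K[n]};
  nf_r : {mpoly K[n]}
}.

(* A history of the algorithm is a sequence st of states, of which step j reads
   only st 0, ..., st j; "nxt" is the state produced by step j. The algorithm is
   nondeterministic in its choice of a divisor, so steps are relations. *)
Section NormalForm.
Variables (K : fieldType) (R : realType) (n s : nat).
Variables (v : valuation K R) (t : R -> K) (w : 'I_n -> R).
Variable (prec : term_order n).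
Variables (gs : 'I_s -> {mpoly K[n]}) (f : {mpoly K[n]}).
Variable (E : {mpoly K[n]} -> {mpoly K[n]} -> nat).

Local Notation S := {mpoly K[n]}.
Local Notation lm := (lm v t w prec).
Local Notation lc := (lc v t w prec).
Local Notation state := (nf_state K n s).

Definition nf_init (st0 : state) : Prop :=
  [/\ nf_T st0 =i codom gs, forall i, nf_h st0 i = 0, nf_q st0 = f
    & nf_r st0 = 0].

Definition nf_divisor (cur : state) (g : S) : Prop :=
  g \in nf_T cur /\ (lm g <= lm (nf_q cur))%MM.

Definition nf_choice (cur : state) (g : S) : Prop :=
  nf_divisor cur g /\
  forall g', nf_divisor cur g' -> (E (nf_q cur) g <= E (nf_q cur) g')%N.

Definition nf_move (cur nxt : state) : Prop :=
  let q := nf_q cur in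
  [/\ ~ exists g, nf_divisor cur g,
      nf_r nxt = nf_r cur + lc q *: 'X_[lm q],
      nf_q nxt = q - lc q *: 'X_[lm q],
      forall i, nf_h nxt i = nf_h cur i
    & nf_T nxt =i q :: nf_T cur].

Definition nf_divide_gen (cur : state) (g p : S) (c : K) (x : 'X_{1..n})
    (nxt : state) : Prop :=
  exists m : 'I_s,
  [/\ g = gs m, nf_q nxt = p,
      nf_h nxt m = nf_h cur m + c *: 'X_[x],
      forall i, i != m -> nf_h nxt i = nf_h cur i
    & nf_r nxt = nf_r cur].

(* c != 1 is part of the step, so that 1 / (1 - c) is a genuine inverse. *)
Definition nf_divide_prev (st : nat -> state) (j : nat) (g p : S) (c : K)
    (nxt : state) : Prop :=
  exists m : nat,
  [/\ (m < j)%N,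
      g = nf_q (st m),
      (g \notin nf_T (st m)) && (g \in nf_T (st m.+1)),
      c != 1
    & [/\ nf_q nxt = (1 - c)^-1 *: p,
          forall i, nf_h nxt i =
            (1 - c)^-1 *: (nf_h (st j) i - c *: nf_h (st m) i)
        & nf_r nxt = (1 - c)^-1 *: (nf_r (st j) - c *: nf_r (st m))]].

Definition nf_divide (st : nat -> state) (j : nat) (g : S) (nxt : state)
    : Prop :=
  let q := nf_q (st j) in
  [/\ nf_choice (st j) g,
      nf_T nxt =i (if (0 < E q g)%N then q :: nf_T (st j) else nf_T (st j))
    & exists x : 'X_{1..n},
        let c := lc q / lc ('X_[x] * g) in
        let p := q - c *: ('X_[x] * g) in
        lm ('X_[x] * g) = lm q /\
        (nf_divide_gen (st j) g p c x nxt \/ nf_divide_prev st j g p c nxt)].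

Definition nf_step (st : nat -> state) (j : nat) (nxt : state) : Prop :=
  nf_q (st j) != 0 /\
  (nf_move (st j) nxt \/ exists g, nf_divide st j g nxt).

(* st 0, ..., st N are the first N + 1 states of an execution. *)
Definition nf_run (N : nat) (st : nat -> state) : Prop :=
  nf_init (st 0%N) /\ forall j, (j < N)%N -> nf_step st j (st j.+1).

End NormalForm.

(* Main.v *)
Require Import Defs.
From HB Require Import structures.
From mathcomp Require Import all_boot all_order all_algebra.
From mathcomp Require Import generic_quotient ring_quotient.
From mathcomp Require Import reals.
From mathcomp Require Import mpoly.
From mathcomp Require Import ring.

(** Order the terms a x^u by val a + w.u, ties being broken in favour of the
    larger x^u; lm p is carried by the least term of p. The polynomials whose
    terms are all at least the leading term of f form a subgroup, stable under
    scalars of nonnegative valuation, and this gives h_i g_i >= f and r >= f.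
    Each step cancels the leading term of q_j, so q_j strictly increases; as all
    q_j are homogeneous of one degree, a division by an earlier q_m has v = 0
    and val c_v > 0, so that 1 - c_v is invertible with inverse of nonnegative
    valuation. With E counting the terms of g missing from q_j, whenever q_j
    enters T its pair (support, leading monomial) is new, and only finitely many
    pairs exist; every other step strictly shrinks the support of q_j. *)

Set Implicit Arguments.
Unset Strict Implicit.
Unset Printing Implicit Defensive.

Import Order.TTheory GRing.Theory Num.Theory.
Local Open Scope ring_scope.

(** * Units, inverses and residues for a valuation *)

Section Valuations.
Variables (K : fieldType) (R : realType) (v : valuation K R).

Lemma valuationV a : a != 0 -> v a^-1 = - v a.
Proof.
move=> a0; apply/eqP; rewrite -addr_eq0 addrC -valuationM ?invr_eq0 //.
by rewrite divff // valuation1.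
Qed.

(** Since 1 = (1 - c) + c has valuation 0 and val c > 0, the ultrametric inequality forces val (1 -
    c) <= 0. *)
Lemma valuation_1B_inv_ge0 c :
  c != 0 -> 0 < v c -> c != 1 -> 0 <= v (1 - c)^-1.
Proof.
move=> c0 vc c1; have d0 : 1 - c != 0 by rewrite subr_eq0 eq_sym.
have := @valuationD _ _ v _ _ d0 c0; rewrite subrK valuation1 oner_neq0.
by move=> /(_ isT); rewrite ge_min (leNgt (v c)) vc orbF valuationV // oppr_ge0.
Qed.

Lemma residue_unit_neq0 a : v a = 0 -> a != 0 -> residue v a != 0.
Proof.
move=> va a0; rewrite /residue.
have aP : a \in valring_pred v by rewrite inE va lexx orbT.
rewrite -[X in _ != X](rmorph0 (\pi_(residue_field v)%qT)).
rewrite -Quotient.idealrBE subr0 inE -(inj_eq val_inj) /= insubdK //.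
by rewrite va ltxx orbF.
Qed.

End Valuations.

(** * Leading exponents for a term order *)

Section LeadingExponent.
Variables (n : nat) (prec : term_order n) (k : nzRingType).

Lemma term_le_refl : reflexive prec.
Proof. by move=> u; have := term_le_total prec u u; rewrite orbb. Qed.

Lemma lead_expP (p : {mpoly k[n]}) : p != 0 ->
  p@_(lead_exp prec p) != 0 /\
  (forall u, p@_u != 0 -> prec u (lead_exp prec p)).
Proof.
rewrite -msupp_eq0 /lead_exp => p0.
have := sort_sorted (@term_le_total _ prec) (msupp p).
rewrite (sorted_pairwise (@term_le_trans _ prec)).
have memE := mem_sort prec (msupp p).
case/lastP: (sort prec (msupp p)) memE => [|s x] memE.
  case: (msupp p) memE p0 => // y s /(_ y).
  by rewrite inE eqxx.
rewrite last_rcons pairwise_rcons => /andP[/allP sx _].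
split=> [|u]; first by rewrite -mcoeff_msupp -memE mem_rcons inE eqxx.
rewrite -mcoeff_msupp -memE mem_rcons inE => /predU1P[->|/sx //].
exact: term_le_refl.
Qed.

End LeadingExponent.

(** * The weighted order on terms, and leading terms of polynomials *)

Section Terms.
Variables (K : fieldType) (R : realType) (n : nat).
Variables (v : valuation K R) (t : R -> K) (w : 'I_n -> R).
Variable (prec : term_order n).
Implicit Types (p q g : {mpoly K[n]}) (x y z : R * 'X_{1..n}).

Local Notation lm := (lm v t w prec).
Local Notation lc := (lc v t w prec).
Local Notation wval := (wval v w).

(* The pair (val a + w . u, u) stands for the term a x^u. *)
Definition tle x y := (x.1 < y.1) || ((x.1 == y.1) && prec y.2 x.2).
Definition tlt x y := tle x y && (x != y).

Lemma tle_refl : reflexive tle.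
Proof. by move=> x; rewrite /tle eqxx term_le_refl orbT. Qed.

Lemma tle_trans : transitive tle.
Proof.
move=> y x z /orP[xy|/andP[/eqP xy pxy]] /orP[yz|/andP[/eqP yz pyz]].
- by rewrite /tle (lt_trans xy yz).
- by rewrite /tle -yz xy.
- by rewrite /tle xy yz.
- by rewrite /tle xy yz eqxx (term_le_trans pyz pxy) orbT.
Qed.

Lemma tle_anti x y : tle x y -> tle y x -> x = y.
Proof.
case: x y => [a u] [b u']; rewrite /tle /=.
case: ltgtP => //= -> p1 p2; congr pair; apply: (@term_le_anti _ prec).
by rewrite p1 p2.
Qed.

Lemma tle_lt_trans y x z : tle x y -> tlt y z -> tlt x z.
Proof.
move=> xy /andP[yz nyz]; rewrite /tlt (tle_trans xy yz) /=.
by apply: contraNneq nyz => xz; rewrite xz in xy; apply/eqP/tle_anti.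
Qed.

Lemma tlt_trans : transitive tlt.
Proof. by move=> y x z /andP[xy _]; apply: tle_lt_trans. Qed.

Definition tshift (a : R) x : R * 'X_{1..n} := (a + x.1, x.2).

Lemma tle_shift a x y : tle (tshift a x) (tshift a y) = tle x y.
Proof. by rewrite /tle /= ltrD2l (inj_eq (addrI a)). Qed.

Lemma tle_shift_ge0 a x y : 0 <= a -> tle x y -> tle x (tshift a y).
Proof.
move=> a0 xy; apply: (tle_trans xy); rewrite /tle /= term_le_refl andbT.
by rewrite orbC -le_eqVlt lerDr.
Qed.

Definition term p (u : 'X_{1..n}) := (wval p@_u u, u).
Definition lterm p := term p (lm p).

(** Bounding all terms, not only the leading one, gives a condition that is vacuous at 0 and
    survives sums in which leading terms cancel. *)
Definition above x p := forall u, p@_u != 0 -> tle x (term p u).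
Definition sabove x p := forall u, p@_u != 0 -> tlt x (term p u).

Lemma above_trans x y p : tle x y -> above y p -> above x p.
Proof. by move=> xy yp u /yp; apply: tle_trans. Qed.

Lemma above0 x : above x 0.
Proof. by move=> u; rewrite mcoeff0 eqxx. Qed.

Lemma termZ a p u : a != 0 -> p@_u != 0 ->
  term (a *: p) u = tshift (v a) (term p u).
Proof. by move=> a0 pu; rewrite /term mcoeffZ /wval valuationM // -addrA. Qed.

Lemma aboveZ_shift a x p : a != 0 -> above x p ->
  above (tshift (v a) x) (a *: p).
Proof.
move=> a0 xp u; rewrite mcoeffZ mulf_eq0 negb_or => /andP[_ pu].
by rewrite termZ // tle_shift xp.
Qed.

Lemma aboveZ a x p : 0 <= v a -> above x p -> above x (a *: p).
Proof.
move=> va xp u; rewrite mcoeffZ mulf_eq0 negb_or => /andP[a0 pu].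
by rewrite termZ // tle_shift_ge0 // xp.
Qed.

Lemma aboveN x p : above x p -> above x (- p).
Proof.
by move=> xp; rewrite -scaleN1r; apply: aboveZ; rewrite // valuationN valuation1.
Qed.

Lemma aboveD x p q : above x p -> above x q -> above x (p + q).
Proof.
move=> xp xq u; rewrite mcoeffD => pq0.
have [p0|p0] := eqVneq p@_u 0.
  by rewrite /term mcoeffD p0 add0r; apply: xq; rewrite p0 add0r in pq0.
have [q0|q0] := eqVneq q@_u 0.
  by rewrite /term mcoeffD q0 addr0; apply: xp.
(* By the ultrametric inequality, one of the two summands at [u] has valuation at most that of the
   sum; [z] is its term. *)
have [z [xz zE]] : exists z, tle x z /\ tle z (term (p + q) u).
  have := valuationD v p0 q0 pq0; rewrite ge_min => /orP[] h.
    exists (term p u); split; first exact: xp.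
    by rewrite /tle /= term_le_refl andbT orbC -le_eqVlt lerD2r mcoeffD.
  exists (term q u); split; first exact: xq.
  by rewrite /tle /= term_le_refl andbT orbC -le_eqVlt lerD2r mcoeffD.
exact: tle_trans xz zE.
Qed.

Lemma aboveB x p q : above x p -> above x q -> above x (p - q).
Proof. by move=> xp xq; apply: aboveD => //; apply: aboveN. Qed.

Lemma sabove_of x p : above x p -> p@_x.2 = 0 -> sabove x p.
Proof.
move=> xp px u pu; rewrite /tlt xp //=.
by apply: contraNneq pu => xE; rewrite -[u]/(term p u).2 -xE px.
Qed.

Lemma term_min_unique p u u' : p@_u != 0 -> p@_u' != 0 ->
  above (term p u) p -> above (term p u') p -> u = u'.
Proof. by move=> pu pu' ap ap'; have [] := tle_anti (ap _ pu') (ap' _ pu). Qed.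

Lemma wminP p : p != 0 ->
  (exists2 u, p@_u != 0 & wval p@_u u = wmin v w p) /\
  forall u, p@_u != 0 -> wmin v w p <= wval p@_u u.
Proof.
rewrite -msupp_eq0 => p0; rewrite /wmin; set u0 := head _ _.
(* The default value of the iterated minimum is the value at [u0], which lies in the support as [p]
   is nonzero; hence the minimum is attained. *)
have u0p : u0 \in msupp p.
  by rewrite /u0; case: (msupp p) p0 => //= a s _; rewrite inE eqxx.
split; last first.
  move=> u; rewrite -mcoeff_msupp => up.
  exact: (@ge_bigmin_seq _ _ _ _ _ u xpredT (fun u => wval p@_u u)).
rewrite big_seq.
apply: (big_ind (fun m => exists2 u, p@_u != 0 & wval p@_u u = m)) => [|a b|u up].
- by exists u0; rewrite // -mcoeff_msupp.
- by rewrite minElt; case: ifP.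
- by exists u; rewrite // -mcoeff_msupp.
Qed.

Hypothesis tP : splitting v t.

Lemma residue_initial_neq0 a : a != 0 -> residue v (t (- v a) * a) != 0.
Proof.
case: tP => t0 _ vt a0.
have va : value_group v (- v a) by exists a^-1; rewrite ?invr_eq0 ?valuationV.
apply: residue_unit_neq0; last by rewrite mulf_neq0 ?t0.
by rewrite valuationM ?t0 // vt // addNr.
Qed.

(** The monomials are distinct and each normalized coefficient has valuation 0, so none is lost on
    passing to the residue field. *)
Lemma mcoeff_inw_neq0 p u :
  ((inw v t w p)@_u != 0) = (p@_u != 0) && (wval p@_u u == wmin v w p).
Proof.
rewrite /inw -big_filter; set r := filter _ _.
pose c u' := if u' \in r then residue v (t (- v p@_u') * p@_u') else 1.
have -> : \sum_(i <- r) residue v (t (- v p@_i) * p@_i) *: 'X_[i] =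
          \sum_(i <- r) c i *: 'X_[i].
  by rewrite big_seq [RHS]big_seq; apply: eq_bigr => i ir; rewrite /c ir.
rewrite -mcoeff_msupp (perm_mem (msupp_sumX _ _)); first last.
- move=> i ir; rewrite /c ir residue_initial_neq0 //.
  by move: ir; rewrite mem_filter mcoeff_msupp => /andP[].
- exact/filter_uniq/msupp_uniq.
by rewrite mem_filter mcoeff_msupp andbC.
Qed.

(** Among the terms of minimal weight, [lm] picks the largest monomial, which is how [tle] breaks
    ties. This replaces initial forms and the residue field by a total order on terms in all that
    follows. *)
Lemma lmP p : p != 0 -> p@_(lm p) != 0 /\ above (lterm p) p.
Proof.
move=> p0; have [[u1 pu1 wu1] minp] := wminP p0.
have i0 : inw v t w p != 0.
  apply/eqP => i0; have := mcoeff_inw_neq0 p u1.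
  by rewrite i0 mcoeff0 eqxx pu1 wu1 eqxx.
have [] := lead_expP prec i0; rewrite -/(lm p) mcoeff_inw_neq0.
move=> /andP[pl /eqP wl] maxp; split=> // u pu.
rewrite /tle /= wl; have := minp _ pu; rewrite le_eqVlt => /orP[/eqP e|->//].
by rewrite -e eqxx ltxx /= maxp // mcoeff_inw_neq0 pu e eqxx.
Qed.

Lemma lm_unique p u : p@_u != 0 -> above (term p u) p -> lm p = u.
Proof.
move=> pu ap; have p0 : p != 0 by apply: contraNneq pu => ->; rewrite mcoeff0.
by have [pl al] := lmP p0; apply: (term_min_unique pl pu al ap).
Qed.

Lemma lc_neq0 p : p != 0 -> lc p != 0.
Proof. by case/lmP. Qed.

Lemma poly_ge_above f p : f != 0 -> above (lterm f) p -> poly_ge v t w prec p f.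
Proof.
move=> f0 fp; rewrite /poly_ge /poly_lt; have [//|p0] := eqVneq p 0.
rewrite (negPf f0) /=; have [pl _] := lmP p0.
have := fp _ pl; rewrite -/(lterm p) /tle /lterm /term /= -/(lc f) -/(lc p).
case: ltgtP => //= _ lepf; apply/negP => /andP[lefp].
by rewrite (@term_le_anti _ prec (lm p) (lm f)) ?eqxx // lepf lefp.
Qed.

Lemma mcoeffXM (x : 'X_{1..n}) p u : ('X_[x] * p)@_(x + u) = p@_u.
Proof. by rewrite mulrC mcoeffMX. Qed.

Lemma mcoeffXM_neq0 (x : 'X_{1..n}) p u :
  ('X_[x] * p)@_u != 0 -> exists2 u', p@_u' != 0 & u = (x + u')%MM.
Proof.
rewrite -mcoeff_msupp mulrC (perm_mem (msuppMX _ _)) => /mapP[u' u'p ->].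
by exists u'; rewrite // -mcoeff_msupp.
Qed.

Lemma termXM (x : 'X_{1..n}) p u :
  term ('X_[x] * p) (x + u)%MM =
  ((term p u).1 + \sum_(i < n) w i * (x i)%:R, (x + u)%MM).
Proof.
rewrite /term mcoeffXM /wval /= -addrA -big_split /=; congr (_ + _, _).
by apply: eq_bigr => i _; rewrite mnmDE natrD mulrDr addrC.
Qed.

(** Multiplication by a monomial adds the same constant to all weights, and the term order is
    compatible with it, so the least term stays least. *)
Lemma lmXM (x : 'X_{1..n}) p : p != 0 -> lm ('X_[x] * p) = (x + lm p)%MM.
Proof.
move=> p0; have [pl al] := lmP p0.
apply: lm_unique; first by rewrite mcoeffXM.
move=> _ /mcoeffXM_neq0[u pu ->]; rewrite !termXM.
have := al _ pu; rewrite /tle /= ltrD2r (inj_eq (addIr _)).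
by case: ltgtP => //= _; apply: term_le_add.
Qed.

Lemma XM_neq0 (x : 'X_{1..n}) p : p != 0 -> 'X_[x] * p != 0.
Proof.
case/lmP=> pl _; apply: contraNneq pl => e.
by rewrite -(mcoeffXM x) e mcoeff0.
Qed.

Lemma lead_term_above p : p != 0 -> above (lterm p) (lc p *: 'X_[lm p]).
Proof.
move=> p0 u; rewrite mcoeffZ mcoeffX; have [<-|] := eqVneq (lm p) u; last first.
  by rewrite mulr0 eqxx.
by rewrite /term mcoeffZ mcoeffX eqxx mulr1 => _; apply: tle_refl.
Qed.

(** The ratio of leading coefficients shifts the leading term of [p] exactly onto that of [q]. *)
Lemma above_lterm_scale p q : p != 0 -> q != 0 -> lm p = lm q ->
  above (lterm q) ((lc q / lc p) *: p).
Proof.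
move=> p0 q0 e; have [_ al] := lmP p0.
have [cq cp] := (lc_neq0 q0, lc_neq0 p0).
have -> : lterm q = tshift (v (lc q / lc p)) (lterm p).
  rewrite /tshift /lterm /term /= e /wval -/(lc q) addrA; congr (_ + _, _).
  by rewrite -e -/(lc p) valuationM ?invr_eq0 // valuationV // addrNK.
by apply: aboveZ_shift; rewrite // mulf_neq0 ?invr_eq0.
Qed.

Lemma cancel_above p q : p != 0 -> q != 0 -> lm p = lm q ->
  above (lterm q) (q - (lc q / lc p) *: p).
Proof.
by move=> p0 q0 e; apply: aboveB; [case: (lmP q0) | apply: above_lterm_scale].
Qed.

Lemma mcoeff_cancel p q : p != 0 -> lm p = lm q ->
  (q - (lc q / lc p) *: p)@_(lm q) = 0.
Proof.
by move=> p0 e; rewrite mcoeffB mcoeffZ -{2}e -/(lc p) divfK ?lc_neq0 // subrr.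
Qed.

Lemma homog_lm p : p != 0 -> p \is homog mdeg -> p \is (mdeg (lm p)).-homog.
Proof.
move=> p0 /homogP[d pd]; have [pl _] := lmP p0.
by rewrite (dhomog_mf pd) // mcoeff_msupp.
Qed.

Lemma mdeg_lm d p : p != 0 -> p \is d.-homog -> mdeg (lm p) = d.
Proof. by case/lmP=> pl _ /dhomog_mf -> //; rewrite mcoeff_msupp. Qed.

(** With equal leading monomials the strict inequality cannot come from the tie-break, so it comes
    from the valuations. *)
Lemma lc_ratio_gt0 p q : p != 0 -> q != 0 -> lm p = lm q ->
  sabove (lterm p) q ->
  0 < v (lc q / lc p).
Proof.
move=> p0 q0 e /(_ (lm q) (lc_neq0 q0)) /andP[/orP le ne].
have {le} : (lterm p).1 < (lterm q).1.
  case: le => // /andP[/eqP h _]; case/eqP: ne; rewrite -/(lterm q).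
  by rewrite [lterm p]surjective_pairing [lterm q]surjective_pairing h /= e.
rewrite /lterm /term /= -/(lc p) -/(lc q) /wval e ltrD2r => h.
by rewrite valuationM ?invr_eq0 ?lc_neq0 // valuationV ?lc_neq0 // subr_gt0.
Qed.

End Terms.

(** * Invariants of an execution *)

Section Runs.
Variables (K : fieldType) (R : realType) (n s : nat).
Variables (v : valuation K R) (t : R -> K) (w : 'I_n -> R).
Variable (prec : term_order n).
Variables (gs : 'I_s -> {mpoly K[n]}) (f : {mpoly K[n]}).
Variable (E : {mpoly K[n]} -> {mpoly K[n]} -> nat).
Variable (d : nat).

Hypothesis tP : splitting v t.
Hypothesis gsP : forall i, gs i != 0 /\ gs i \is homog mdeg.
Hypothesis fd : f \is d.-homog.

Local Notation lm := (lm v t w prec).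
Local Notation lc := (lc v t w prec).
Local Notation lterm := (lterm v t w prec).
Local Notation above := (above v w prec).
Local Notation sabove := (sabove v w prec).
Local Notation state := (nf_state K n s).

Section Invariant.
Variable st : nat -> state.
Local Notation q j := (nf_q (st j)).
Local Notation T j := (nf_T (st j)).
Local Notation h j := (nf_h (st j)).
Local Notation r j := (nf_r (st j)).

(** The condition under which step (v) may use [q m]; keeping it in the invariant supplies the index
    [m] when such a division has to be built. *)
Definition added_at (m : nat) (g : {mpoly K[n]}) : Prop :=
  g = q m /\ (g \notin T m) && (g \in T m.+1).

(** [inv_lt] compares with every earlier polynomial, since a division may use any of them. *)
Record nf_inv (j : nat) : Prop := NFInv {
  inv_homog : q j \is d.-homog;
  inv_T : forall g, g \in T j -> [/\ g != 0, g \is homog mdeg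
    & (exists i, g = gs i) \/ (exists2 m, (m < j)%N & added_at m g)];
  inv_gens : forall i, gs i \in T j;
  inv_lt : forall m, (m < j)%N -> sabove (lterm (q m)) (q j)
}.

(** The arithmetic of a step without [T] and [E]. For a division by an earlier [q m], the quotient
    monomial is already 1 and val c > 0 is recorded. *)
Variant nf_update (j : nat) : Prop :=
| UpdateMove of
    (forall i, ~~ (lm (gs i) <= lm (q j))%MM)
  & q j.+1 = q j - lc (q j) *: 'X_[lm (q j)]
  & r j.+1 = r j + lc (q j) *: 'X_[lm (q j)]
  & (forall i, h j.+1 i = h j i)
| UpdateGen (m : 'I_s) (x : 'X_{1..n}) (c : K) of
    lm ('X_[x] * gs m) = lm (q j)
  & c = lc (q j) / lc ('X_[x] * gs m)
  & q j.+1 = q j - c *: ('X_[x] * gs m)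
  & r j.+1 = r j
  & h j.+1 m = h j m + c *: 'X_[x]
  & (forall i, i != m -> h j.+1 i = h j i)
| UpdatePrev (m : nat) (c : K) of
    (m < j)%N & q m != 0 & lm (q m) = lm (q j)
  & c = lc (q j) / lc (q m) & c != 0 & c != 1 & 0 < v c
  & q j.+1 = (1 - c)^-1 *: (q j - c *: q m)
  & r j.+1 = (1 - c)^-1 *: (r j - c *: r m)
  & (forall i, h j.+1 i = (1 - c)^-1 *: (h j i - c *: h m i)).

(** Compare the degrees of the two leading monomials. *)
Lemma monom_mul_same_degree g p (x : 'X_{1..n}) : g != 0 -> p != 0 ->
  g \is d.-homog -> p \is d.-homog -> lm ('X_[x] * g) = lm p -> x = 0%MM.
Proof.
move=> g0 p0 gd pd; rewrite (lmXM _ _ tP) // => /(congr1 mdeg).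
rewrite mdegD !(mdeg_lm _ _ tP _ (d := d)) // => /eqP.
by rewrite -[X in _ == X]add0n eqn_add2r mdeg_eq0 => /eqP.
Qed.

(** The strict increase of the [q j] gives val c > 0, whereas val 1 = 0; thus the algorithm never
    divides by zero in step (v). *)
Lemma prev_ratio j m : (m < j)%N -> nf_inv j -> q j != 0 -> q m != 0 ->
  lm (q m) = lm (q j) ->
  let c := lc (q j) / lc (q m) in [/\ c != 0, c != 1 & 0 < v c].
Proof.
move=> mj ij qj qm e c.
have vc : 0 < v c by apply: lc_ratio_gt0 => //; apply: inv_lt.
split=> //; first by rewrite mulf_neq0 ?invr_eq0 ?lc_neq0.
by apply: contraTneq vc => ->; rewrite valuation1 ltxx.
Qed.

Lemma nf_step_update j : (forall m, (m <= j)%N -> nf_inv m) ->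
  nf_step v t w prec gs E st j (st j.+1) ->
  [/\ q j != 0, nf_update j &
      T j.+1 =i q j :: T j \/ T j.+1 =i T j].
Proof.
move=> inv [q0 [[nodiv rE qE hE TE]|[g [[[gT gdiv] _] TE [x [lmE stepE]]]]]].
  split=> //; last by left.
  apply: UpdateMove => // i; apply/negP => gi; case: nodiv; exists (gs i).
  by split=> //; apply: inv_gens (inv _ (leqnn j)) _.
split=> //; last by case: ifP TE; [left | right].
case: stepE => [[m [gE qE hE hE' rE]]|[m [mj gE _ c1 [qE hE rE]]]].
  by subst g; apply: (UpdateGen (m := m) (x := x)).
have [g0 _ _] := inv_T (inv _ (leqnn j)) gT.
have gd := inv_homog (inv _ (ltnW mj)); rewrite -gE in gd.
have x0 := monom_mul_same_degree g0 q0 gd (inv_homog (inv _ (leqnn j))) lmE.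
rewrite x0 mpolyX0 mul1r in c1 qE hE rE lmE.
subst g; have [c0 _ vc] := prev_ratio mj (inv _ (leqnn j)) q0 g0 lmE.
exact: (UpdatePrev mj).
Qed.

Lemma sabove_trans p0 p1 p2 : p1 != 0 -> sabove (lterm p0) p1 ->
  sabove (lterm p1) p2 -> sabove (lterm p0) p2.
Proof.
move=> p10 p01 p12 u /p12; apply: tlt_trans; apply: p01.
by case: (lmP w prec tP p10).
Qed.

Lemma homog_monom_mul g p (x : 'X_{1..n}) : g != 0 -> g \is homog mdeg ->
  p != 0 -> p \is d.-homog -> lm ('X_[x] * g) = lm p ->
  'X_[x] * g \is d.-homog /\ (mdeg x + mdeg (lm g))%N = d.
Proof.
move=> g0 gh p0 pd e.
have xd : (mdeg x + mdeg (lm g))%N = d.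
  by rewrite -mdegD -(lmXM _ _ tP) // e (mdeg_lm _ _ tP _ pd).
split=> //; rewrite -xd; apply: dhomogM; first by rewrite dhomogX.
exact: homog_lm.
Qed.

(** In each case a polynomial with the leading term of [q j] is subtracted, and the result is at
    most rescaled by an element of nonnegative valuation. *)
Lemma update_q j : (forall m, (m <= j)%N -> nf_inv m) -> q j != 0 ->
  nf_update j ->
  [/\ q j.+1 \is d.-homog, above (lterm (q j)) (q j.+1)
    & (q j.+1)@_(lm (q j)) = 0].
Proof.
move=> inv q0; have qd := inv_homog (inv _ (leqnn j)).
have lead0 : (q j - lc (q j) *: 'X_[lm (q j)])@_(lm (q j)) = 0.
  by rewrite mcoeffB mcoeffZ mcoeffX eqxx mulr1 subrr.
case=> [_ -> _ _|m x c e -> -> _ _ _|m c mj qm e -> c0 c1 vc -> _ _].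
- split=> //.
    by rewrite rpredB ?rpredZ // dhomogX; apply/eqP/mdeg_lm.
  apply: aboveB; first by case: (lmP w prec tP q0).
  exact: lead_term_above.
- have [g0 gh] := gsP m; have xg0 := XM_neq0 w prec tP x g0.
  have [xgd _] := homog_monom_mul g0 gh q0 qd e.
  split; [by rewrite rpredB ?rpredZ | exact: cancel_above | exact: mcoeff_cancel].
- have qmd := inv_homog (inv _ (ltnW mj)).
  split; first by rewrite !(rpredB, rpredZ).
    apply: aboveZ; first exact: valuation_1B_inv_ge0.
    exact: cancel_above.
  by rewrite mcoeffZ (mcoeff_cancel tP) ?mulr0.
Qed.

Lemma nf_inv_step j : (forall m, (m <= j)%N -> nf_inv m) ->
  nf_step v t w prec gs E st j (st j.+1) -> nf_inv j.+1.
Proof.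
move=> inv /(nf_step_update inv)[q0 upd TE].
have ij := inv _ (leqnn j); have [qd ql qc] := update_q inv q0 upd.
have Tsub g : g \in T j -> g \in T j.+1.
  by case: TE => -> //; rewrite inE => ->; rewrite orbT.
have Told g : g \in T j -> [/\ g != 0, g \is homog mdeg &
    (exists i, g = gs i) \/ (exists2 m, (m < j.+1)%N & added_at m g)].
  move=> /(inv_T ij)[g0 gh gO]; split=> //; case: gO; first by left.
  by case=> m mj am; right; exists m => //; apply: ltnW.
split=> // [g gT|i|m].
- have [/Told //|gnT] := boolP (g \in T j).
  case: TE (gT) => -> ; last by move/Told.
  rewrite inE (negPf gnT) orbF => /eqP gE.
  split; [by rewrite gE|by rewrite gE (homogE (inv_homog ij))|right].
  by exists j => //; split=> //; rewrite gnT.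
- exact/Tsub/(inv_gens ij).
(* The bound is strict because the monomial [lm (q j)] has been cancelled; earlier indices follow by
   transitivity. *)
- have sq : sabove (lterm (q j)) (q j.+1) by apply: sabove_of.
  rewrite ltnS leq_eqVlt => /predU1P[-> //|mj].
  exact: sabove_trans q0 (inv_lt ij mj) sq.
Qed.

(** The induction is strong because a step may refer to any earlier state. *)
Lemma nf_run_inv N : nf_run v t w prec gs f E N st ->
  forall j, (j <= N)%N -> nf_inv j.
Proof.
move=> [[T0 h0 q0 r0] steps]; elim/ltn_ind=> -[|j] IH jN.
  split=> [|g|i|] //; rewrite ?q0 ?T0 ?codom_f //.
  by move=> /codomP[i ->]; have [? ?] := gsP i; split=> //; left; exists i.
apply: nf_inv_step (steps _ jN) => m mj.
by apply: IH; rewrite ?ltnS // (leq_trans mj (ltnW jN)).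
Qed.

(** * Correctness of the partial quotients and remainders *)

(** [corr_q] carries the bound from which those on new summands follow. The truncated subtraction is
    harmless: dividing by [gs i] requires [mdeg (lm (gs i)) <= d], and 0 is homogeneous of every
    degree. *)
Record nf_correct (j : nat) : Prop := NFCorrect {
  corr_sum : f = \sum_(i < s) h j i * gs i + q j + r j;
  corr_hg : forall i, above (lterm f) (h j i * gs i);
  corr_q : above (lterm f) (q j);
  corr_r : above (lterm f) (r j);
  corr_h_homog : forall i, h j i \is (d - mdeg (lm (gs i))).-homog;
  corr_r_homog : r j \is d.-homog;
  corr_normal : forall u, (r j)@_u != 0 -> forall i, ~~ (lm (gs i) <= u)%MM
}.

Lemma nf_correct_step j : (forall m, (m <= j)%N -> nf_inv m) ->
  (forall m, (m <= j)%N -> nf_correct m) -> q j != 0 -> nf_update j ->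
  nf_correct j.+1.
Proof.
move=> inv corr q0 upd; have [sE hgE qE rE hh rh nE] := corr _ (leqnn j).
have qd := inv_homog (inv _ (leqnn j)).
have [ql aq] := lmP w prec tP q0; have fq := qE _ ql.
have fq' : above (lterm f) (q j.+1).
  by have [_ aq' _] := update_q inv q0 upd; apply: above_trans aq'.
case: upd fq' => [ndiv qE' rE' hE' fq'|m x c e cE qE' rE' hE' hE'' fq'
    |m c mj qm e cE c0 c1 vc qE' rE' hE' fq'].
- have lr : above (lterm f) (lc (q j) *: 'X_[lm (q j)]).
    by apply: above_trans fq _; apply: lead_term_above.
  split; rewrite ?rE' //.
  + under eq_bigr => i _ do rewrite hE'.
    by rewrite qE' {1}sE; ring.
  + by move=> i; rewrite hE'.
  + exact: aboveD.
  + by move=> i; rewrite hE'.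
  + by rewrite rpredD ?rpredZ // dhomogX; apply/eqP/mdeg_lm.
  + move=> u; rewrite mcoeffD mcoeffZ mcoeffX.
    have [<- _ //|_] := eqVneq (lm (q j)) u.
    by rewrite mulr0 addr0; apply: nE.
- have [g0 gh] := gsP m; have xg0 := XM_neq0 w prec tP x g0.
  have [xgd xd] := homog_monom_mul g0 gh q0 qd e.
  have cxg : above (lterm f) (c *: ('X_[x] * gs m)).
    by rewrite cE; apply: above_trans fq _; apply: above_lterm_scale.
  split; rewrite ?rE' //.
  + rewrite qE' (bigD1 m) //= hE'.
    under eq_bigr => i im do rewrite hE'' //.
    rewrite {1}sE (bigD1 m) //= mulrDl -scalerAl.
    set A := h j m * _; set B := \sum_(_ < _ | _) _; set C := c *: _.
    by ring.
  + move=> i; have [->|im] := eqVneq i m; last by rewrite hE''.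
    by rewrite hE' mulrDl -scalerAl; apply: aboveD.
  + move=> i; have [->|im] := eqVneq i m; last by rewrite hE''.
    by rewrite hE' rpredD ?rpredZ // dhomogX -xd addnK.
(* All data become (1 - c)^-1 times the data at [j] minus c times those at [m]; both scalars have
   nonnegative valuation, so the bounds persist. *)
- have [sEm hgEm qEm rEm hhm rhm nEm] := corr _ (ltnW mj).
  have d0 : 1 - c != 0 by rewrite subr_eq0 eq_sym.
  have v0 := valuation_1B_inv_ge0 c0 vc c1.
  split; rewrite ?rE' //.
  (* After multiplication by 1 - c, the identity is the one at [j] minus c times the one at [m]. *)
  + apply: (can_inj (scalerK d0)).
    rewrite qE' !scalerDr !scalerA divff // !scale1r scaler_sumr.
    under eq_bigr => i _ do
      rewrite hE' scalerAl scalerA divff // scale1r mulrBl -scalerAl.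
    rewrite scalerBl scale1r sumrB -scaler_sumr.
    move: sE sEm; set A := \sum_(_ < _) _; set B := \sum_(_ < _) _ => fA fB.
    by rewrite {1}fA {1}fB -!mul_mpolyC; ring.
  + move=> i; rewrite hE' -scalerAl mulrBl -scalerAl.
    by apply: aboveZ => //; apply: aboveB => //; apply: aboveZ; rewrite ?ltW.
  + by apply: aboveZ => //; apply: aboveB => //; apply: aboveZ; rewrite ?ltW.
  + by move=> i; rewrite hE' !(rpredB, rpredZ).
  + by rewrite !(rpredB, rpredZ).
  (* A monomial of the new remainder occurs in [r j] or in [r m]. *)
  + move=> u ru i; have [r0|/nE //] := eqVneq (r j)@_u 0.
    apply: nEm; apply: contraNneq ru => rm0.
    by rewrite mcoeffZ mcoeffB mcoeffZ r0 rm0 mulr0 subr0 mulr0.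
Qed.

Lemma nf_run_correct N : nf_run v t w prec gs f E N st ->
  forall j, (j <= N)%N -> nf_correct j.
Proof.
move=> run; have inv := nf_run_inv run; have [[T0 h0 q0 r0] steps] := run.
elim/ltn_ind=> -[|j] IH jN.
  split; rewrite ?q0 ?r0 //.
  - by rewrite big1 ?add0r ?addr0 // => i _; rewrite h0 mul0r.
  - by move=> i; rewrite h0 mul0r; apply: above0.
  - by have [->|f0] := eqVneq f 0; [apply: above0 | case: (lmP w prec tP f0)].
  - exact: above0.
  - by move=> i; rewrite h0 rpred0.
  - by rewrite rpred0.
  - by move=> u; rewrite mcoeff0 eqxx.
have invj m : (m <= j)%N -> nf_inv m.
  by move=> mj; apply/inv/(leq_trans mj (ltnW jN)).
have [qj upd _] := nf_step_update invj (steps _ jN).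
apply: nf_correct_step => // m mj.
by apply: IH; rewrite ?ltnS // (leq_trans mj (ltnW jN)).
Qed.

(** * Existence of a next step *)

(** The next state is given by formulas; the only possible obstruction, c = 1, is excluded by
    [prev_ratio]. *)
Lemma nf_divide_exists N g : nf_run v t w prec gs f E N st -> q N != 0 ->
  nf_choice v t w prec E (st N) g ->
  exists nxt, nf_divide v t w prec gs E st N g nxt.
Proof.
move=> run qN gC; have inv := nf_run_inv run; have iN := inv _ (leqnn N).
have [[gT gdiv] gmin] := gC; have [g0 gh gO] := inv_T iN gT.
have lmE : lm ('X_[(lm (q N) - lm g)%MM] * g) = lm (q N).
  by rewrite (lmXM _ _ tP) // submK.
set x := (lm (q N) - lm g)%MM in lmE.
pose c := lc (q N) / lc ('X_[x] * g); pose p := q N - c *: ('X_[x] * g).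
pose T' := if (0 < E (q N) g)%N then q N :: T N else T N.
have T'E : T' =i (if (0 < E (q N) g)%N then q N :: T N else T N) by [].
case: gO => [[m gE]|[m mN [gE gA]]].
  exists (NFState T'
    (fun i => if i == m then h N m + c *: 'X_[x] else h N i) p (r N)).
  split=> //; exists x; split=> //; left; exists m; split=> //=; rewrite ?eqxx //.
  by move=> i /negPf ->.
have gd := inv_homog (inv _ (ltnW mN)); rewrite -gE in gd.
have x0 := monom_mul_same_degree g0 qN gd (inv_homog iN) lmE.
have c1 : c != 1.
  rewrite /c; move: lmE; rewrite x0 mpolyX0 mul1r gE => lmE.
  by rewrite gE in g0; have [] := prev_ratio mN iN qN g0 lmE.
exists (NFState T' (fun i => (1 - c)^-1 *: (h N i - c *: h m i))
  ((1 - c)^-1 *: p) ((1 - c)^-1 *: (r N - c *: r m))).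
by split=> //; exists x; split=> //; right; exists m; split.
Qed.

Lemma nf_step_exists N : nf_run v t w prec gs f E N st -> q N != 0 ->
  exists nxt, nf_step v t w prec gs E st N nxt.
Proof.
move=> run qN; have [/hasP[g gT gdiv]|/hasPn nodiv] :=
    boolP (has (fun g => lm g <= lm (q N))%MM (T N)); last first.
  exists (NFState (q N :: T N) (h N) (q N - lc (q N) *: 'X_[lm (q N)])
    (r N + lc (q N) *: 'X_[lm (q N)])).
  by split=> //; left; split=> // -[g [/nodiv/negP]].
(* The least value of [E] attained on divisors yields an admissible choice. *)
pose P k := has (fun g => (lm g <= lm (q N))%MM && (E (q N) g == k)) (T N).
have exP : exists k, P k.
  by exists (E (q N) g); apply/hasP; exists g; rewrite ?gdiv ?eqxx.
case: (ex_minnP exP) => k /hasP[g' g'T /andP[g'div /eqP g'E]] kmin.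
have g'C : nf_choice v t w prec E (st N) g'.
  split=> // g2 [g2T g2div]; rewrite g'E; apply: kmin.
  by apply/hasP; exists g2; rewrite ?g2div ?eqxx.
have [nxt ?] := nf_divide_exists run qN g'C.
by exists nxt; split=> //; right; exists g'.
Qed.

End Invariant.
End Runs.

(** * Termination when [E] counts missing terms *)

Section Termination.
Variables (K : fieldType) (R : realType) (n s : nat).
Variables (v : valuation K R) (t : R -> K) (w : 'I_n -> R).
Variable (prec : term_order n).
Variables (gs : 'I_s -> {mpoly K[n]}) (f : {mpoly K[n]}).
Variable (d : nat).

Hypothesis tP : splitting v t.
Hypothesis gsP : forall i, gs i != 0 /\ gs i \is homog mdeg.
Hypothesis fd : f \is d.-homog.

Local Notation lm := (lm v t w prec).
Local Notation monom := 'X_{1..n < d.+1}.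

Definition supp_set (p : {mpoly K[n]}) : {set monom} :=
  [set u : monom | p@_u != 0].

(** The leading monomial is stored as a set, a singleton when its degree is at most [d], so that
    signatures form a finite type without any degree proof. *)
Definition signature (p : {mpoly K[n]}) : {set monom} * {set monom} :=
  (supp_set p, [set u : monom | bmnm u == lm p]).

Lemma supp_setP p (u : 'X_{1..n}) : p \is d.-homog -> p@_u != 0 ->
  exists2 u' : monom, bmnm u' = u & u' \in supp_set p.
Proof.
move=> pd pu; have ud : (mdeg u < d.+1)%N.
  by rewrite ltnS (dhomog_mf pd) // mcoeff_msupp.
by exists (BMultinom ud); rewrite // inE.
Qed.

Lemma signature_lm p p' : p' != 0 -> p' \is d.-homog ->
  signature p = signature p' -> lm p = lm p'.
Proof.
move=> p0 pd [_ /setP sE]; have [pl _] := lmP w prec tP p0.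
have [u uE _] := supp_setP pd pl.
by have := sE u; rewrite !inE -uE eqxx => /eqP <-.
Qed.

Lemma Esupp_eq0 (p p' : {mpoly K[n]}) :
  reflect (forall u, p'@_u != 0 -> p@_u != 0) (Esupp p p' == 0%N).
Proof.
rewrite /Esupp eqn0Ngt -has_count; apply: (iffP hasPn) => sub u.
  by rewrite -mcoeff_msupp => /sub.
by rewrite mcoeff_msupp => /sub.
Qed.

Lemma signature_Esupp p p' : p' \is d.-homog -> signature p = signature p' ->
  Esupp p p' = 0%N.
Proof.
move=> p'd [/setP sE _]; apply/eqP/Esupp_eq0 => u /(supp_setP p'd)[u' <-].
by rewrite -sE inE.
Qed.

Variable st : nat -> nf_state K n s.
Hypothesis run : forall N, nf_run v t w prec gs f (@Esupp K n) N st.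
Local Notation q j := (nf_q (st j)).
Local Notation T j := (nf_T (st j)).

(** Every [q j] has degree [d], and in that degree a signature determines the support. *)
Definition signatures j : {set {set monom} * {set monom}} :=
  [set x | has (fun g => (g \is d.-homog) && (signature g == x)) (T j)].

Lemma signaturesP j x :
  reflect (exists g, [/\ g \in T j, g \is d.-homog & signature g = x])
    (x \in signatures j).
Proof.
rewrite inE; apply: (iffP hasP) => [[g gT /andP[gd /eqP gx]]|[g [gT gd gx]]].
  by exists g.
by exists g; rewrite ?gd ?gx /=.
Qed.

(* If E > 0 or no divisor exists, then q_j is added to T, and no element of T
   had its support and leading monomial: such an element would be a divisor
   with E = 0. If E = 0, the division is by a polynomial of the same degree
   whose support lies in that of q_j, so the support shrinks. *)
Lemma nf_step_progress j :
  signatures j \proper signatures j.+1 \/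
  (signatures j = signatures j.+1 /\ supp_set (q j.+1) \proper supp_set (q j)).
Proof.
have inv m := nf_run_inv tP gsP fd (run m) (leqnn m).
have [_ /(_ j (ltnSn j)) stepj] := run j.+1.
have [q0 upd TE] := nf_step_update tP (fun m _ => inv m) stepj.
have [qd' _ qc] := update_q tP gsP (fun m _ => inv m) q0 upd.
have qd := inv_homog (inv j).
have [ql _] := lmP w prec tP q0.
have grow : T j.+1 =i q j :: T j -> signature (q j) \notin signatures j ->
    signatures j \proper signatures j.+1.
  move=> T'E new; apply/properP; split.
    apply/subsetP => x /signaturesP[g [gT gd gx]]; apply/signaturesP; exists g.
    by rewrite T'E inE gT orbT.
  exists (signature (q j)) => //; apply/signaturesP; exists (q j).
  by rewrite T'E inE eqxx.
have old_div g : g \in T j -> g \is d.-homog -> signature g = signature (q j) ->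
    nf_divisor v t w prec (st j) g.
  by move=> gT gd /(signature_lm q0 qd) e; split; rewrite // e lepm_refl.
case: stepj => _ [[nodiv _ _ _ T'E]|[g [gC T'E stepE]]].
  left; apply: grow => //; apply/signaturesP => -[g [gT gd gx]].
  by apply: nodiv; exists g; apply: old_div.
case: ltnP T'E => [Epos T'E|]; [left|rewrite leqn0 => /Esupp_eq0 E0 T'E; right].
  apply: grow => //; apply/signaturesP => -[g' [gT gd gx]].
  have := gC.2 _ (old_div _ gT gd gx).
  by rewrite (signature_Esupp gd) // leqNgt Epos.
split.
  apply/setP => x; apply/signaturesP/signaturesP => -[g' [gT gd gx]];
  by exists g'; rewrite ?T'E // -?T'E.
have [g0 gh _] := inv_T (inv j) gC.1.1.
(* As the support of [g] lies in that of [q j], even an input polynomial [g] has degree [d] here, so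
   the quotient monomial is 1. *)
have gd : g \is d.-homog.
  apply/dhomogP => u; rewrite mcoeff_msupp => /E0.
  by rewrite -mcoeff_msupp => /(dhomog_mf qd).
case: stepE => x [lmE]; have x0 := monom_mul_same_degree tP g0 q0 gd qd lmE.
rewrite x0 mpolyX0 mul1r; set c := lc _ _ _ _ _ / _; set p := q j - _ => stepE.
have psub u : (q j.+1)@_u != 0 -> (q j)@_u != 0.
  apply: contraNneq => qu; have gu : g@_u = 0.
    by apply/eqP; apply: contraTT isT => /E0; rewrite qu eqxx.
  have pu : p@_u = 0 by rewrite /p mcoeffB mcoeffZ qu gu mulr0 subr0.
  by case: stepE => [[m [_ -> _ _ _]]|[m [_ _ _ _ [-> _ _]]]];
    rewrite ?mcoeffZ pu ?mulr0.
apply/properP; split; first by apply/subsetP => u; rewrite !inE; apply: psub.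
have [u uE us] := supp_setP qd ql; exists u => //.
by rewrite inE uE qc eqxx.
Qed.

Lemma nf_run_not_infinite : False.
Proof.
pose B := #|{: monom}|; pose F := #|{: {set monom} * {set monom}}|.
(* A lexicographic measure in base [B.+1]: first the signatures still missing, then the support
   size, which is at most [B]. *)
pose M j := ((F - #|signatures j|) * B.+1 + #|supp_set (q j)|)%N.
have dec j : (M j.+1 < M j)%N.
  have leB k : (#|supp_set (q k)| <= B)%N by apply: max_card.
  rewrite /M; case: (nf_step_progress j) => [/proper_card lt|[-> /proper_card lt]].
    have leF : (#|signatures j.+1| <= F)%N by apply: max_card.
    have : ((F - #|signatures j.+1|).+1 * B.+1 <= (F - #|signatures j|) * B.+1)%N.
      by rewrite leq_mul2r ltn_sub2l ?orbT // (leq_trans lt).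
    rewrite mulSn => le; apply: leq_trans (leq_trans le (leq_addr _ _)).
    by rewrite addnC ltn_add2r ltnS.
  by rewrite ltn_add2l.
(* This fails at j = M 0 + 1. *)
have bound j : (M j + j <= M 0)%N.
  elim: j => [|j IH]; first by rewrite addn0.
  by apply: leq_trans IH; rewrite addnS -addSn leq_add2r.
by have := leq_trans (leq_addl _ _) (bound (M 0%N).+1); rewrite ltnn.
Qed.

End Termination.

Theorem mainTheorem2 (K : fieldType) (R : realType) (n s : nat)
    (v : valuation K R) (t : R -> K) (w : 'I_n -> R) (prec : term_order n)
    (g : 'I_s -> {mpoly K[n]}) (f : {mpoly K[n]}) :
  splitting v t ->
  (forall i, g i != 0 /\ g i \is homog mdeg) ->
  f \is homog mdeg ->
  [/\ (* whatever E, an execution never gets stuck before q_j = 0, and every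
         admissible choice of divisor can be carried out *)
      forall (E : {mpoly K[n]} -> {mpoly K[n]} -> nat) N st,
        nf_run v t w prec g f E N st -> nf_q (st N) != 0 ->
        (exists nxt, nf_step v t w prec g E st N nxt) /\
        (forall d, nf_choice v t w prec E (st N) d ->
           exists nxt, nf_divide v t w prec g E st N d nxt),
      (* for E(f, g) = |{u : b_u <> 0, c_u = 0}|, every execution terminates *)
      ~ (exists st, forall N,
           nf_run v t w prec g f (@Esupp K n) N st)
    & (* whatever E, the output of an execution that terminates is correct *)
      forall (E : {mpoly K[n]} -> {mpoly K[n]} -> nat) N st,
        nf_run v t w prec g f E N st -> nf_q (st N) = 0 ->
        let h := nf_h (st N) in
        let r := nf_r (st N) in
        [/\ (forall i, h i \is homog mdeg) /\ r \is homog mdeg,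
            f = \sum_(i < s) h i * g i + r,
            forall i, poly_ge v t w prec (h i * g i) f,
            poly_ge v t w prec r f
          & forall u, r@_u != 0 -> forall i, ~~ (lm v t w prec (g i) <= u)%MM]].
Proof.
move=> tP gsP /homogP[d fd]; split.
- move=> E N st run qN; split; first exact: (nf_step_exists tP gsP fd run).
  by move=> g' gC; apply: (nf_divide_exists tP gsP fd run).
- by case=> st run; apply: (nf_run_not_infinite tP gsP fd run).
move=> E N st run qN h r.
have [sE hgE _ rE hh rh nE] := nf_run_correct tP gsP fd run (leqnn N).
(* The bounds by [lterm f] are informative only for nonzero [f]. If f = 0, the loop is never entered
   and all outputs are 0. *)
have f_case : f != 0 \/ N = 0%N.
  have [f0|] := eqVneq f 0; [right|by left].
  case: N run {qN h r sE hgE rE hh rh nE} => // N [[_ _ q0 _] /(_ 0%N isT)[]].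
  by rewrite q0 f0 eqxx.
split=> //.
- by split=> [i|]; [apply: homogE (hh i) | apply: homogE rh].
- by rewrite {1}sE qN addr0.
- move=> i; case: f_case => [f0|N0]; first exact: (poly_ge_above tP).
  by case: run => -[_ h0 _ _] _; rewrite /h N0 h0 mul0r /poly_ge /poly_lt eqxx.
- case: f_case => [f0|N0]; first exact: (poly_ge_above tP).
  by case: run => -[_ _ _ r0] _; rewrite /r N0 r0 /poly_ge /poly_lt eqxx.
Qed.
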